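(* Let $\mathcal{C}$ be a tensor category over an algebraically closed field $k$, and let $\mathrm{Proj}(\mathcal{C})$ denote the full subcategory of projective objects. Then: (1) If $\mathcal{I}$ is a non-zero right or left tensor ideal in $\mathcal{C}$, then $\mathrm{Proj}(\mathcal{C})$ is a sub-ideal of $\mathcal{I}$ (i.e. $\mathrm{Proj}(\mathcal{C})\subset\mathcal{I}$). In particular, $\mathrm{Proj}(\mathcal{C})$ contains no right or left sub-ideal other than zero and itself. Suppose now in addition that $\mathrm{Proj}(\mathcal{C})\neq 0$. Then: (2) $\mathrm{Proj}(\mathcal{C})=(P)$ for any non-zero projective object $P$, where $(P)$ is the right tensor ideal generated by $P$. (3) $\mathcal{C}$ admits a non-zero proper (two-sided) tensor ideal if and only if $\mathcal{C}$ is not semisimple.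
   Context: A tensor category over $k$ is a $k$-linear abelian category which is locally finite (finite-dimensional Hom-spaces, every object has finite length), monoidal with bilinear tensor product $\otimes$ and simple tensor unit $\mathbf{1}$, and rigid (every object has a left and a right dual). Existence of projective covers is not assumed. A right tensor ideal $\mathcal{I}$ of $\mathcal{C}$ is a full subcategory such that (i) $X\otimes V\in\mathcal{I}$ for all $X\in\mathcal{I}$, $V\in\mathcal{C}$; (ii) it is closed under retracts: if $Z\in\mathcal{I}$ and $Z\cong X\oplus Y$ then $X,Y\in\mathcal{I}$. Left ideals are defined analogously (with $V\otimes X$), and two-sided ideals (just ''ideals'') are both. A sub-ideal is an ideal contained in another one; an ideal is proper if it is not all of $\mathcal{C}$, and zero if it contains only zero objects. $\mathrm{Proj}(\mathcal{C})$ is a two-sided ideal. For $P\in\mathcal{C}$, the right ideal $(P)$ generated by $P$ consists of all objects that are retracts of $P\otimes X$ for some $X\in\mathcal{C}$. *)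

(* Defs.v *)
From mathcomp Require Import all_boot all_order all_algebra.

Set Implicit Arguments.
Unset Strict Implicit.
Unset Printing Implicit Defensive.

Import GRing.Theory.
Local Open Scope ring_scope.

Declare Scope cat_scope.
Delimit Scope cat_scope with cat.

(* The finite-dimensionality of the Hom-spaces is carried by [vectType]. *)
Record linearCategory (k : fieldType) := LinearCategory {
  obj :> Type;
  hom : obj -> obj -> vectType k;
  idm : forall X, hom X X;
  comp : forall X Y Z, hom Y Z -> hom X Y -> hom X Z;
  comp_assoc : forall X Y Z W (h : hom Z W) (g : hom Y Z) (f : hom X Y),
    comp h (comp g f) = comp (comp h g) f;
  comp_idl : forall X Y (f : hom X Y), comp (idm Y) f = f;
  comp_idr : forall X Y (f : hom X Y), comp f (idm X) = f;
  comp_linearl : forall X Y Z (f : hom X Y), linear (fun g : hom Y Z => comp g f);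
  comp_linearr : forall X Y Z (g : hom Y Z), linear (fun f : hom X Y => comp g f)
}.

Arguments hom {k C} X Y : rename.
Arguments idm {k C} X : rename.
Arguments comp {k C X Y Z} g f : rename.

Notation "g ∘ f" := (comp g f)
  (at level 40, left associativity) : cat_scope.
Local Open Scope cat_scope.

Section Category.
Variables (k : fieldType) (C : linearCategory k).
Implicit Types X Y Z K Q S P : C.

Definition is_mono X Y (f : hom X Y) : Prop :=
  forall Z (g h : hom Z X), f ∘ g = f ∘ h -> g = h.

Definition is_epi X Y (f : hom X Y) : Prop :=
  forall Z (g h : hom Y Z), g ∘ f = h ∘ f -> g = h.

Definition is_inverse X Y (f : hom X Y) (g : hom Y X) : Prop :=
  g ∘ f = idm X /\ f ∘ g = idm Y.

Definition is_iso X Y (f : hom X Y) : Prop := exists g, is_inverse f g.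

Definition is_zero_object Z : Prop :=
  (forall X (f : hom X Z), f = 0) /\ (forall X (f : hom Z X), f = 0).

Definition is_kernel X Y (f : hom X Y) K (i : hom K X) : Prop :=
  f ∘ i = 0 /\
  forall Z (g : hom Z X), f ∘ g = 0 -> exists! h : hom Z K, i ∘ h = g.

Definition is_cokernel X Y (f : hom X Y) Q (p : hom Y Q) : Prop :=
  p ∘ f = 0 /\
  forall Z (g : hom Y Z), g ∘ f = 0 -> exists! h : hom Q Z, h ∘ p = g.

Definition short_exact X Y Z (i : hom X Y) (p : hom Y Z) : Prop :=
  is_kernel p i /\ is_cokernel i p.

(* [Z] is isomorphic to the direct sum of [X] and [Y]. *)
Definition is_direct_sum Z X Y : Prop :=
  exists (i1 : hom X Z) (i2 : hom Y Z) (p1 : hom Z X) (p2 : hom Z Y),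
    [/\ p1 ∘ i1 = idm X, p2 ∘ i2 = idm Y, p1 ∘ i2 = 0, p2 ∘ i1 = 0
      & i1 ∘ p1 + i2 ∘ p2 = idm Z].

Definition is_retract X Z : Prop :=
  exists (i : hom X Z) (r : hom Z X), r ∘ i = idm X.

Record is_abelian : Prop := IsAbelian {
  ab_zero : exists Z, is_zero_object Z;
  ab_sum : forall X Y, exists Z, is_direct_sum Z X Y;
  ab_kernel : forall X Y (f : hom X Y), exists K (i : hom K X), is_kernel f i;
  ab_cokernel : forall X Y (f : hom X Y), exists Q (p : hom Y Q), is_cokernel f p;
  ab_mono : forall X Y (f : hom X Y), is_mono f ->
    exists Z (g : hom Y Z), is_kernel g f;
  ab_epi : forall X Y (f : hom X Y), is_epi f ->
    exists Z (g : hom Z X), is_cokernel g f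
}.

Definition is_simple S : Prop :=
  ~ is_zero_object S /\
  forall Y (i : hom Y S), is_mono i -> is_zero_object Y \/ is_iso i.

(* A composition series of [X], built from the bottom up. *)
Inductive finite_length : C -> Prop :=
| finite_length_zero Z : is_zero_object Z -> finite_length Z
| finite_length_ext X Y S (i : hom X Y) (p : hom Y S) :
    short_exact i p -> finite_length X -> is_simple S -> finite_length Y.

(* Finite direct sums of simple objects. *)
Inductive semisimple_object : C -> Prop :=
| semisimple_zero Z : is_zero_object Z -> semisimple_object Z
| semisimple_sum Z S Y :
    is_direct_sum Z S Y -> is_simple S -> semisimple_object Y ->
    semisimple_object Z.

Definition is_semisimple : Prop := forall X, semisimple_object X.

Definition projective P : Prop :=
  forall Y Z (e : hom Y Z), is_epi e ->
  forall f : hom P Z, exists g : hom P Y, e ∘ g = f.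

End Category.

Record monoidalStructure (k : fieldType) (C : linearCategory k) :=
  MonoidalStructure {
  tens : C -> C -> C;
  tensm : forall X X' Y Y' : C,
    hom X X' -> hom Y Y' -> hom (tens X Y) (tens X' Y');
  tunit : C;
  assoc : forall X Y Z, hom (tens (tens X Y) Z) (tens X (tens Y Z));
  associ : forall X Y Z, hom (tens X (tens Y Z)) (tens (tens X Y) Z);
  lunit : forall X, hom (tens tunit X) X;
  runit : forall X, hom (tens X tunit) X;
  tensm_id : forall X Y, tensm (idm X) (idm Y) = idm (tens X Y);
  tensm_comp : forall (X X' X'' Y Y' Y'' : C)
    (f' : hom X' X'') (f : hom X X') (g' : hom Y' Y'') (g : hom Y Y'),
    tensm (f' ∘ f) (g' ∘ g) = tensm f' g' ∘ tensm f g;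
  tensm_linearl : forall (X X' Y Y' : C) (g : hom Y Y'),
    linear (fun f : hom X X' => tensm f g);
  tensm_linearr : forall (X X' Y Y' : C) (f : hom X X'),
    linear (fun g : hom Y Y' => tensm f g);
  assoc_inverse : forall X Y Z, is_inverse (assoc X Y Z) (associ X Y Z);
  lunit_iso : forall X, is_iso (lunit X);
  runit_iso : forall X, is_iso (runit X);
  assoc_natural : forall (X X' Y Y' Z Z' : C)
    (f : hom X X') (g : hom Y Y') (h : hom Z Z'),
    assoc X' Y' Z' ∘ tensm (tensm f g) h = tensm f (tensm g h) ∘ assoc X Y Z;
  lunit_natural : forall (X X' : C) (f : hom X X'),
    lunit X' ∘ tensm (idm tunit) f = f ∘ lunit X;
  runit_natural : forall (X X' : C) (f : hom X X'),
    runit X' ∘ tensm f (idm tunit) = f ∘ runit X;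
  pentagon : forall X Y Z W,
    assoc X Y (tens Z W) ∘ assoc (tens X Y) Z W =
    tensm (idm X) (assoc Y Z W) ∘
      (assoc X (tens Y Z) W ∘ tensm (assoc X Y Z) (idm W));
  triangle : forall X Y,
    tensm (idm X) (lunit Y) ∘ assoc X tunit Y = tensm (runit X) (idm Y)
}.

Arguments tunit {k C} m : rename.

(* [D] is a left dual of [X], equivalently [X] is a right dual of [D].  The
   zigzag identities are precomposed with a unitor, which spares its inverse. *)
Definition dual_pair (k : fieldType) (C : linearCategory k)
    (M : monoidalStructure C) (D X : C) : Prop :=
  exists (ev : hom (tens M D X) (tunit M)) (coev : hom (tunit M) (tens M X D)),
    runit M X ∘ (tensm M (idm X) ev ∘
      (assoc M X D X ∘ tensm M coev (idm X))) = lunit M X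
    /\
    lunit M D ∘ (tensm M ev (idm D) ∘
      (associ M D X D ∘ tensm M (idm D) coev)) = runit M D.

Record tensorCategory (k : fieldType) := TensorCategory {
  tc_cat :> linearCategory k;
  tc_abelian : is_abelian tc_cat;
  tc_length : forall X : tc_cat, finite_length X;
  tc_mon : monoidalStructure tc_cat;
  tc_unit_simple : is_simple (tunit tc_mon);
  tc_left_dual : forall X, exists D, dual_pair tc_mon D X;
  tc_right_dual : forall X, exists D, dual_pair tc_mon X D
}.

Notation "X ⊗ Y" := (tens (tc_mon _) X Y)
  (at level 40, left associativity) : cat_scope.

(* Full subcategories are represented by predicates on objects. *)
Section Ideals.
Variables (k : fieldType) (C : tensorCategory k).
Implicit Types (I J : C -> Prop) (P X Y Z V : C).

Definition retract_closed I : Prop :=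
  forall X Y Z, I Z -> is_direct_sum Z X Y -> I X /\ I Y.

Definition right_ideal I : Prop :=
  (forall X V, I X -> I (X ⊗ V)) /\ retract_closed I.

Definition left_ideal I : Prop :=
  (forall X V, I X -> I (V ⊗ X)) /\ retract_closed I.

Definition tensor_ideal I : Prop := right_ideal I /\ left_ideal I.

Definition Proj : C -> Prop := @projective k C.

Definition sub_class J I : Prop := forall X, J X -> I X.

Definition zero_class I : Prop := forall X, I X -> is_zero_object X.

Definition proper_class I : Prop := ~ (forall X, I X).

Definition generated_right_ideal P : C -> Prop :=
  fun Z => exists X, is_retract Z (P ⊗ X).

End Ideals.

Arguments Proj {k} C P.

(* Main.v *)
(** If [X] is non-zero and [D] is a dual of [X], the evaluation [X ⊗ D -> 1] is
    non-zero, hence epi because the unit is simple.  Tensoring with a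
    projective [P] keeps it epi, so it splits and [P] is a retract of
    [X ⊗ (D ⊗ P)]: every projective lies in every right ideal containing [X].
    Left ideals are right ideals of the category with the opposite tensor
    product.  If all objects are projective, composition series split and the
    category is semisimple; conversely, in a semisimple category the evaluation
    itself splits, so a non-zero ideal contains the unit. *)
From Stdlib Require Import Classical.
From mathcomp Require Import all_boot all_algebra.
Require Import Defs.

Set Implicit Arguments.
Unset Strict Implicit.
Unset Printing Implicit Defensive.

Import GRing.Theory.
Local Open Scope ring_scope.
Local Open Scope cat_scope.

(** * Retracts, simple objects and projectives in a linear abelian category *)

Section LinearCategory.
Variables (k : fieldType) (C : linearCategory k).
Implicit Types X Y Z K S P : C.

Lemma comp_addl X Y Z (g h : hom Y Z) (f : hom X Y) :
  (g + h) ∘ f = g ∘ f + h ∘ f.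
Proof. by have := comp_linearl f 1 g h; rewrite !scale1r. Qed.

Lemma comp_addr X Y Z (g : hom Y Z) (f h : hom X Y) :
  g ∘ (f + h) = g ∘ f + g ∘ h.
Proof. by have := comp_linearr g 1 f h; rewrite !scale1r. Qed.

Lemma comp0l X Y Z (f : hom X Y) : (0 : hom Y Z) ∘ f = 0.
Proof. by apply: (addrI (0 ∘ f)); rewrite -comp_addl !addr0. Qed.

Lemma comp0r X Y Z (g : hom Y Z) : g ∘ (0 : hom X Y) = 0.
Proof. by apply: (addrI (g ∘ 0)); rewrite -comp_addr !addr0. Qed.

Lemma comp_subl X Y Z (g h : hom Y Z) (f : hom X Y) :
  (g - h) ∘ f = g ∘ f - h ∘ f.
Proof. by apply/eqP; rewrite eq_sym subr_eq -comp_addl subrK. Qed.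

Lemma comp_subr X Y Z (g : hom Y Z) (f h : hom X Y) :
  g ∘ (f - h) = g ∘ f - g ∘ h.
Proof. by apply/eqP; rewrite eq_sym subr_eq -comp_addr subrK. Qed.

Lemma zero_objectP X : is_zero_object X <-> idm X = 0.
Proof.
split=> [[X0 _]|X0]; first exact: X0.
split=> Y f.
  by rewrite -(comp_idl f) X0 comp0l.
by rewrite -(comp_idr f) X0 comp0r.
Qed.

Lemma kernel_mono X Y (f : hom X Y) K (i : hom K X) : is_kernel f i -> is_mono i.
Proof.
case=> fi0 univ Z g h igh.
have [|u [_ uniq]] := univ Z (i ∘ g); first by rewrite comp_assoc fi0 comp0l.
by rewrite -(uniq g) // -(uniq h).
Qed.

Lemma cokernel_epi X Y (f : hom X Y) Q (p : hom Y Q) :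
  is_cokernel f p -> is_epi p.
Proof.
case=> pf0 univ Z g h gph.
have [|u [_ uniq]] := univ Z (g ∘ p); first by rewrite -comp_assoc pf0 comp0r.
by rewrite -(uniq g) // -(uniq h).
Qed.

Lemma zero_kernel_mono X Y (f : hom X Y) K (i : hom K X) :
  is_kernel f i -> is_zero_object K -> is_mono f.
Proof.
case=> _ univ [K0 _] Z g h fgh; apply/eqP; rewrite -subr_eq0; apply/eqP.
have [|u [<- _]] := univ Z (g - h); first by rewrite comp_subr fgh subrr.
by rewrite (K0 _ u) comp0r.
Qed.

Lemma comp_iso_eq0 X Y K (f : hom X Y) (i : hom K X) :
  f ∘ i = 0 -> is_iso i -> f = 0.
Proof.
by move=> fi0 [j [_ ij]]; rewrite -(comp_idr f) -ij comp_assoc fi0 comp0l.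
Qed.

Lemma iso_retract X Y (f : hom X Y) : is_iso f -> is_retract Y X.
Proof. by case=> g [_ fg]; exists g, f. Qed.

Lemma retract_trans X Y Z : is_retract X Y -> is_retract Y Z -> is_retract X Z.
Proof.
move=> [i [r ri]] [j [s sj]]; exists (j ∘ i), (r ∘ s).
by rewrite -comp_assoc (comp_assoc s) sj comp_idl.
Qed.

Lemma iso_epi X Y (f : hom X Y) : is_iso f -> is_epi f.
Proof.
move=> [s [_ fs]] Z g h E.
by rewrite -(comp_idr g) -(comp_idr h) -fs !comp_assoc E.
Qed.

Lemma epi_comp X Y Z (f : hom Y Z) (e : hom X Y) :
  is_epi f -> is_epi e -> is_epi (f ∘ e).
Proof. by move=> epif epie W g h; rewrite !comp_assoc => /epie/epif. Qed.

Lemma direct_sum_sym Z X Y : is_direct_sum Z X Y -> is_direct_sum Z Y X.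
Proof.
move=> [i1 [i2 [p1 [p2 [? ? ? ? sum]]]]]; exists i2, i1, p2, p1.
by split=> //; rewrite addrC.
Qed.

Lemma direct_sum_retract Z X Y : is_direct_sum Z X Y -> is_retract X Z.
Proof. by move=> [i1 [i2 [p1 [p2 []]]]]; exists i1, p1. Qed.

Lemma split_kernel_direct_sum X Y S (i : hom X Y) (p : hom Y S) (s : hom S Y) :
  is_kernel p i -> p ∘ s = idm S -> is_direct_sum Y S X.
Proof.
move=> ker ps; have imono := kernel_mono ker; case: ker => pi0 univ.
(* The projection onto [X] is the factorization through [i] of the idempotent complementary to
   [s ∘ p]; its identities follow by cancelling the mono [i]. *)
have [|q [iq _]] := univ Y (idm Y - s ∘ p).
  by rewrite comp_subr comp_idr comp_assoc ps comp_idl subrr.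
exists s, i, p, q; split=> //.
- apply: imono; rewrite comp_assoc iq comp_subl comp_idl comp_idr.
  by rewrite -comp_assoc pi0 comp0r subr0.
- apply: imono; rewrite comp_assoc iq comp_subl comp_idl comp0r.
  by rewrite -comp_assoc ps comp_idr subrr.
- by rewrite iq addrC subrK.
Qed.

Lemma epi_projective_retract P Y (e : hom Y P) :
  projective P -> is_epi e -> is_retract P Y.
Proof. by move=> projP epie; have [s es] := projP _ _ e epie (idm P); exists s, e. Qed.

Lemma retract_projective X P : is_retract X P -> projective P -> projective X.
Proof.
move=> [i [r ri]] projP Y Z e epie f.
have [g eg] := projP _ _ e epie (f ∘ r).
by exists (g ∘ i); rewrite comp_assoc eg -comp_assoc ri comp_idr.
Qed.

Hypothesis abC : is_abelian C.

Lemma retract_direct_sum X Z : is_retract X Z -> exists Y, is_direct_sum Z X Y.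
Proof.
move=> [i [r ri]]; have [K [j ker]] := ab_kernel abC r.
by exists K; apply: split_kernel_direct_sum ker ri.
Qed.

(** If [g ∘ f = h ∘ f], then [f] factors through the kernel of [g - h]. This subobject of [S] is
    zero or everything, and zero would force [f = 0]. *)
Lemma nonzero_to_simple_epi X S (f : hom X S) : is_simple S -> f != 0 -> is_epi f.
Proof.
move=> [_ simS] f0 Z g h gfh; apply/eqP; rewrite -subr_eq0; apply/eqP.
have [K [i ker]] := ab_kernel abC (g - h).
have [K0|isoi] := simS K i (kernel_mono ker); last exact: comp_iso_eq0 ker.1 isoi.
have [|u [iu _]] := ker.2 X f; first by rewrite comp_subl gfh subrr.
by case/eqP: f0; rewrite -iu (K0.1 _ u) comp0r.
Qed.

(** The kernel of [f] cannot be all of [S], so it is zero and [f] is mono; simplicity of [T] then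
    leaves only an isomorphism, as [S] is non-zero. *)
Lemma schur S T (f : hom S T) : is_simple S -> is_simple T -> f != 0 -> is_iso f.
Proof.
move=> [S0 simS] [_ simT] f0; have [K [i ker]] := ab_kernel abC f.
have [K0|isoi] := simS K i (kernel_mono ker); last first.
  by case/eqP: f0; apply: comp_iso_eq0 ker.1 isoi.
by have [|] := simT S f (zero_kernel_mono ker K0).
Qed.

(** Induction on the decomposition of [Z]: either [f] is non-zero on the simple summand, where
    Schur's lemma applies, or it is non-zero on the remaining one. *)
Lemma semisimple_to_simple_retract Z S (f : hom Z S) :
  semisimple_object Z -> is_simple S -> f != 0 -> is_retract S Z.
Proof.
move=> ssZ simS; elim: ssZ f => {Z} [Z Z0|Z T Y sum simT _ IH] f f0.
  by case/eqP: f0; apply: Z0.2.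
have retT := direct_sum_retract sum.
have retY := direct_sum_retract (direct_sum_sym sum).
case: sum => i1 [i2 [p1 [p2 [_ _ _ _ sum]]]].
have [fi1|fi1] := eqVneq (f ∘ i1) 0; last first.
  exact: retract_trans (iso_retract (schur simT simS fi1)) retT.
have [fi2|fi2] := eqVneq (f ∘ i2) 0; last exact: retract_trans (IH _ fi2) retY.
case/eqP: f0; rewrite -(comp_idr f) -sum comp_addr !comp_assoc fi1 fi2.
by rewrite !comp0l addr0.
Qed.

Lemma all_projective_semisimple :
  (forall X, finite_length X) -> (forall X, projective X) -> is_semisimple C.
Proof.
move=> finlen proj X; elim: (finlen X) => {X} [Z|X Y S i p [ker coker] _ ssX simS].
  exact: semisimple_zero.
have [s ps] := proj S _ _ p (cokernel_epi coker) (idm S).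
by apply: semisimple_sum ssX; [apply: split_kernel_direct_sum ker ps|].
Qed.

End LinearCategory.

(** * Monoidal coherence and the adjunction given by a dual *)

Section Monoidal.
Variables (k : fieldType) (C : linearCategory k) (M : monoidalStructure C).
Implicit Types X Y Z V D W : C.

Local Notation "X ⊗ Y" := (tens M X Y) : cat_scope.
Local Notation "f ⊠ g" := (tensm M f g) (at level 39, no associativity) : cat_scope.

Lemma tensm_compl X X' X'' Y (f' : hom X' X'') (f : hom X X') :
  (f' ∘ f) ⊠ idm Y = f' ⊠ idm Y ∘ f ⊠ idm Y.
Proof. by rewrite -tensm_comp comp_idl. Qed.

Lemma tensm_compr X Y Y' Y'' (f' : hom Y' Y'') (f : hom Y Y') :
  idm X ⊠ (f' ∘ f) = idm X ⊠ f' ∘ idm X ⊠ f.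
Proof. by rewrite -tensm_comp comp_idl. Qed.

Lemma tensm0l X X' Y Y' (g : hom Y Y') : (0 : hom X X') ⊠ g = 0.
Proof.
have := tensm_linearl M g 1 (0 : hom X X') 0; rewrite !scale1r addr0 => E.
by apply: (addrI (0 ⊠ g)); rewrite -E addr0.
Qed.

Lemma assocK X Y Z : associ M X Y Z ∘ assoc M X Y Z = idm _.
Proof. by case: (assoc_inverse M X Y Z). Qed.

Lemma associK X Y Z : assoc M X Y Z ∘ associ M X Y Z = idm _.
Proof. by case: (assoc_inverse M X Y Z). Qed.

Lemma assoc_cancell X Y Z W (f g : hom W ((X ⊗ Y) ⊗ Z)) :
  assoc M X Y Z ∘ f = assoc M X Y Z ∘ g -> f = g.
Proof.
by move=> E; rewrite -(comp_idl f) -(comp_idl g) -assocK -!comp_assoc E.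
Qed.

Lemma associ_natural X X' Y Y' Z Z' (f : hom X X') (g : hom Y Y') (h : hom Z Z') :
  associ M X' Y' Z' ∘ f ⊠ (g ⊠ h) = (f ⊠ g) ⊠ h ∘ associ M X Y Z.
Proof.
apply: assoc_cancell; rewrite !comp_assoc associK comp_idl assoc_natural.
by rewrite -comp_assoc associK comp_idr.
Qed.

Lemma tensm_unit_inj X Y (f g : hom X Y) :
  f ⊠ idm (tunit M) = g ⊠ idm (tunit M) -> f = g.
Proof.
move=> E; have [r [_ rr]] := runit_iso M X.
by rewrite -(comp_idr f) -(comp_idr g) -rr !comp_assoc -!runit_natural E.
Qed.

(* Kelly: [- ⊗ 1] is faithful, and after it the identity is a face of the
   pentagon on [X, Y, 1, 1]. *)
Lemma runit_tens X Y : runit M (X ⊗ Y) = idm X ⊠ runit M Y ∘ assoc M X Y (tunit M).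
Proof.
apply: tensm_unit_inj; apply: assoc_cancell.
rewrite tensm_compl comp_assoc assoc_natural -!triangle tensm_compr.
rewrite -tensm_id comp_assoc assoc_natural -!comp_assoc.
by rewrite pentagon !comp_assoc.
Qed.

Lemma runit_tens_associ X Y :
  runit M (X ⊗ Y) ∘ associ M X Y (tunit M) = idm X ⊠ runit M Y.
Proof. by rewrite runit_tens -comp_assoc associK comp_idr. Qed.

(** The pentagon with two associators moved across, the form needed both for the triangle identity
    of the adjunction and for the mirrored pentagon. *)
Lemma pentagon_associ X Y Z W :
  assoc M (X ⊗ Y) Z W ∘ associ M X Y Z ⊠ idm W =
  associ M X Y (Z ⊗ W) ∘ (idm X ⊠ assoc M Y Z W ∘ assoc M X (Y ⊗ Z) W).
Proof.
apply: assoc_cancell; rewrite !comp_assoc associK comp_idl pentagon.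
by rewrite -!comp_assoc -tensm_compl associK tensm_id comp_idr.
Qed.

(* The unit starts at [X ⊗ 1] rather than at [X], which spares a choice of
   inverses of the unitors. *)
Lemma dual_adjunction D V : dual_pair M D V ->
  exists (eta : forall X, hom (X ⊗ tunit M) ((X ⊗ V) ⊗ D))
      (eps : forall X, hom ((X ⊗ D) ⊗ V) X),
    [/\ forall X Y (f : hom X Y),
          (f ⊠ idm V) ⊠ idm D ∘ eta X = eta Y ∘ f ⊠ idm (tunit M),
        forall X Y (f : hom X Y), eps Y ∘ (f ⊠ idm D) ⊠ idm V = f ∘ eps X
      & forall X, eps (X ⊗ V) ∘ eta X ⊠ idm V = runit M X ⊠ idm V].
Proof.
move=> [ev [coev [zigzag _]]].
exists (fun X => associ M X V D ∘ idm X ⊠ coev).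
exists (fun X => runit M X ∘ (idm X ⊠ ev ∘ assoc M X D V)); split=> [X Y f|X Y f|X].
- rewrite comp_assoc -associ_natural -!comp_assoc tensm_id -!tensm_comp.
  by rewrite !comp_idl !comp_idr.
- rewrite -!comp_assoc assoc_natural (comp_assoc _ _ (assoc _ _ _ _)) tensm_id.
  rewrite -tensm_comp comp_idl comp_idr -{1}(comp_idr f) -{1}(comp_idl ev).
  by rewrite tensm_comp !comp_assoc runit_natural.
(* Coherence moves [coev] and [ev] into the right-hand factor, where they form [idm X] tensored with
   the first zigzag; what remains is the triangle axiom. *)
- rewrite tensm_compl -!comp_assoc (comp_assoc (assoc _ _ _ _)).
  rewrite pentagon_associ -!comp_assoc assoc_natural.
  rewrite (comp_assoc (idm (X ⊗ V) ⊠ ev)) -tensm_id -associ_natural.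
  rewrite !comp_assoc runit_tens_associ -!tensm_compr -triangle -zigzag.
  by rewrite !tensm_compr !comp_assoc.
Qed.

(** Removes the extra unit factor that [eta] carries in its source. *)
Lemma runit_tensm_cancel X V Z (f g : hom (X ⊗ V) Z) :
  f ∘ runit M X ⊠ idm V = g ∘ runit M X ⊠ idm V -> f = g.
Proof.
have [s [_ rs]] := runit_iso M X => E.
by rewrite -(comp_idr f) -(comp_idr g) -tensm_id -rs tensm_compl !comp_assoc E.
Qed.

(** Tensoring with [V] is left adjoint to tensoring with [D], and left adjoints preserve
    epimorphisms: the transposes of [g] and [h] agree after [e]. *)
Lemma tens_epi D V X Y (e : hom X Y) :
  dual_pair M D V -> is_epi e -> is_epi (e ⊠ idm V).
Proof.
move=> /dual_adjunction [eta [eps [etaN epsN triangle]]] epie Z g h E.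
(* Transposes start at [Y ⊗ 1], so [e ⊠ 1] is what has to be cancelled; it is [e] conjugated by
   unitors. *)
have e1epi : is_epi (e ⊠ idm (tunit M)).
  have [t [tr rt]] := runit_iso M Y.
  rewrite -(comp_idl (e ⊠ _)) -tr -comp_assoc runit_natural.
  apply: epi_comp; first by apply: iso_epi; exists (runit M Y).
  exact: epi_comp epie (iso_epi (runit_iso M X)).
have Eeta : g ⊠ idm D ∘ eta Y = h ⊠ idm D ∘ eta Y.
  by apply: e1epi; rewrite -!comp_assoc -etaN !comp_assoc -!tensm_compl E.
apply: runit_tensm_cancel; rewrite -triangle !comp_assoc -!epsN -!comp_assoc.
by rewrite -!tensm_compl Eeta.
Qed.

(** A left adjoint preserves projectives when its right adjoint preserves epis. Here the right
    adjoint tensors with [D], which preserves epis because [D] has the dual [D']. *)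
Lemma tens_projective D D' V P :
  dual_pair M D V -> dual_pair M D' D -> projective P -> projective (P ⊗ V).
Proof.
move=> /dual_adjunction [eta [eps [_ epsN triangle]]] dualD projP Y Z e epie f.
have [s [sr rs]] := runit_iso M P.
(* The map lifted is the transpose of [f], with [s] supplying the unit factor; transposing the lift
   back gives the witness below. *)
have [g eg] := projP _ _ _ (tens_epi dualD epie) (f ⊠ idm D ∘ eta P ∘ s).
exists (eps Y ∘ g ⊠ idm V); rewrite comp_assoc -epsN -comp_assoc -tensm_compl eg.
rewrite !tensm_compl !comp_assoc epsN -2!comp_assoc (comp_assoc _ _ (s ⊠ _)).
by rewrite triangle -tensm_compl rs tensm_id comp_idr.
Qed.

(** With [ev = 0] the zigzag would make the unitor of [X], an isomorphism, equal to zero. *)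
Lemma dual_ev_neq0 D X (ev : hom (X ⊗ D) (tunit M)) (coev : hom (tunit M) (D ⊗ X)) :
  lunit M X ∘ (ev ⊠ idm X ∘ (associ M X D X ∘ idm X ⊠ coev)) = runit M X ->
  ~ is_zero_object X -> ev != 0.
Proof.
move=> zigzag X0; apply/eqP=> ev0; apply/X0/zero_objectP.
have [s [_ <-]] := runit_iso M X.
by rewrite -zigzag ev0 tensm0l !(comp0l, comp0r).
Qed.

(** * The opposite tensor product *)

Definition mirror_monoidal : monoidalStructure C.
Proof.
refine (@MonoidalStructure k C (fun X Y => Y ⊗ X) (fun X X' Y Y' f g => g ⊠ f)
  (tunit M) (fun X Y Z => associ M Z Y X) (fun X Y Z => assoc M Z Y X)
  (runit M) (lunit M) _ _ _ _ _ _ _ _ _ _ _ _).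
- by move=> X Y; apply: tensm_id.
- by move=> *; apply: tensm_comp.
- by move=> *; apply: tensm_linearr.
- by move=> *; apply: tensm_linearl.
- by move=> X Y Z; split; [apply: associK|apply: assocK].
- exact: runit_iso.
- exact: lunit_iso.
- by move=> *; rewrite associ_natural.
- by move=> *; apply: runit_natural.
- by move=> *; apply: lunit_natural.
(* Composing with the two associators inverse to the left side turns it into an identity;
   [pentagon_associ] collapses the right side in the same way. *)
- move=> X Y Z W; apply: assoc_cancell; apply: assoc_cancell.
  rewrite (comp_assoc (assoc M (W ⊗ Z) Y X)) associK comp_idl associK.
  rewrite (comp_assoc (assoc M (W ⊗ Z) Y X)) pentagon_associ.
  rewrite -!comp_assoc (comp_assoc (assoc _ _ (Z ⊗ Y) _)) associK comp_idl.
  by rewrite -tensm_compr associK tensm_id comp_idr associK.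
- by move=> X Y; rewrite -triangle -comp_assoc associK comp_idr.
Defined.

End Monoidal.

(** Left and right duals trade places. The definition is transparent, so that a left ideal of [C] is
    by conversion a right ideal of [mirror C], while [Proj] is unchanged. *)
Definition mirror (k : fieldType) (C : tensorCategory k) : tensorCategory k.
Proof.
refine (@TensorCategory k (tc_cat C) (tc_abelian C) (@tc_length k C)
  (mirror_monoidal (tc_mon C)) (tc_unit_simple C) _ _) => X.
  have [D [ev [coev [? ?]]]] := tc_right_dual X.
  by exists D, ev, coev.
have [D [ev [coev [? ?]]]] := tc_left_dual X.
by exists D, ev, coev.
Defined.

(** * Tensor ideals and projective objects *)

Section TensorCategory.
Variables (k : fieldType) (C : tensorCategory k).
Implicit Types (I J : C -> Prop) (P X Y Z V D : C).

(** In an abelian category a retract has a complement, the kernel of the retraction, so retracts and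
    direct summands coincide. *)
Lemma retract_closedP I :
  retract_closed I <-> (forall X Z, is_retract X Z -> I Z -> I X).
Proof.
split=> [clI X Z /(retract_direct_sum (tc_abelian C)) [Y sum] IZ|clI X Y Z IZ sum].
  by have [] := clI _ _ _ IZ sum.
have retY := direct_sum_retract (direct_sum_sym sum).
by split; [apply: clI (direct_sum_retract sum) IZ|apply: clI retY IZ].
Qed.

Lemma retract_closed_Proj : retract_closed (Proj C).
Proof. by apply/retract_closedP => X Z; apply: retract_projective. Qed.

Lemma right_ideal_Proj : right_ideal (Proj C).
Proof.
split; last exact: retract_closed_Proj.
move=> P V projP; have [D dualV] := tc_left_dual V.
by have [D' dualD] := tc_left_dual D; apply: tens_projective dualV dualD projP.
Qed.

Lemma right_dual_ev X : ~ is_zero_object X ->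
  exists D (ev : hom (X ⊗ D) (tunit (tc_mon C))), ev != 0.
Proof.
move=> X0; have [D [ev [coev [_ zigzag]]]] := tc_right_dual X.
by exists D, ev; apply: dual_ev_neq0 zigzag X0.
Qed.

Lemma projective_retract_tens X P :
  ~ is_zero_object X -> Proj C P -> exists V, is_retract P (X ⊗ V).
Proof.
move=> X0 projP; have [D [ev ev0]] := right_dual_ev X0.
have [D' dualP] := tc_left_dual P.
have epi_ev := nonzero_to_simple_epi (tc_abelian C) (tc_unit_simple C) ev0.
(* The epi is [(X ⊗ D) ⊗ P -> 1 ⊗ P -> P]; reassociating its source gives the witness [D ⊗ P]. *)
have epi_evP := epi_comp (iso_epi (lunit_iso (tc_mon C) P)) (tens_epi dualP epi_ev).
exists (D ⊗ P); apply: retract_trans (epi_projective_retract projP epi_evP) _.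
by exists (assoc _ X D P), (associ _ X D P); apply: assocK.
Qed.

Lemma not_zero_classP I :
  ~ zero_class I -> exists2 X : C, I X & ~ is_zero_object X.
Proof.
move=> I0; have [X nIX] := not_all_ex_not _ _ I0.
by have [IX X0] := imply_to_and _ _ nIX; exists X.
Qed.

Lemma right_ideal_Proj_sub I :
  right_ideal I -> ~ zero_class I -> sub_class (Proj C) I.
Proof.
move=> [tensI /retract_closedP retI] /not_zero_classP [X IX X0] P projP.
have [V ret] := projective_retract_tens X0 projP.
by apply: retI ret _; apply: tensI.
Qed.

Lemma semisimple_ideal_full I :
  is_semisimple C -> right_ideal I -> left_ideal I -> ~ zero_class I ->
  forall X, I X.
Proof.
move=> ssC [tensI /retract_closedP retI] [tensIl _] /not_zero_classP [X IX X0] Y.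
have [D [ev ev0]] := right_dual_ev X0.
have ret1 := semisimple_to_simple_retract (tc_abelian C) (ssC _) (tc_unit_simple C) ev0.
have I1 := retI _ _ ret1 (tensI _ _ IX).
exact: retI (iso_retract (runit_iso (tc_mon C) Y)) (tensIl _ _ I1).
Qed.

End TensorCategory.

Lemma tensor_ideal_Proj (k : fieldType) (C : tensorCategory k) :
  tensor_ideal (Proj C).
Proof. by split; [apply: right_ideal_Proj|apply: (@right_ideal_Proj k (mirror C))]. Qed.

Lemma ideal_Proj_sub (k : fieldType) (C : tensorCategory k) (I : C -> Prop) :
  right_ideal I \/ left_ideal I -> ~ zero_class I -> sub_class (Proj C) I.
Proof.
by case=> idI; [apply: right_ideal_Proj_sub|apply: (@right_ideal_Proj_sub k (mirror C))].
Qed.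

Theorem proposition2p4 (k : closedFieldType) (C : tensorCategory k) :
  (* (1) *)
  ((forall I : C -> Prop, right_ideal I \/ left_ideal I -> ~ zero_class I ->
      tensor_ideal (Proj C) /\ sub_class (Proj C) I) /\
   (forall J : C -> Prop, right_ideal J \/ left_ideal J ->
      sub_class J (Proj C) ->
      zero_class J \/ (forall X : C, J X <-> Proj C X))) /\
  (~ zero_class (Proj C) ->
   (* (2) *)
   (forall P : C, Proj C P -> ~ is_zero_object P ->
      forall X : C, Proj C X <-> generated_right_ideal P X) /\
   (* (3) *)
   ((exists I : C -> Prop, [/\ tensor_ideal I, ~ zero_class I & proper_class I]) <->
    ~ is_semisimple C)).
Proof.
split.
  split=> [I idI I0|J idJ subJ].
    by split; [apply: tensor_ideal_Proj|apply: ideal_Proj_sub].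
  have [J0|J0] := classic (zero_class J); [by left|right=> X].
  by split; [apply: subJ|apply: ideal_Proj_sub].
move=> Proj0; split=> [P projP P0 X|].
  split=> [|[V ret]]; first exact: projective_retract_tens.
  exact: retract_projective ret ((right_ideal_Proj C).1 _ V projP).
split=> [[I [[rI lI] I0 properI]] ssC|nssC].
  exact: properI (semisimple_ideal_full ssC rI lI I0).
(* [Proj C] itself is the witness: it is non-zero by assumption, and were it everything, composition
   series would split. *)
exists (Proj C); split=> [|//|allP]; first exact: tensor_ideal_Proj.
by apply: nssC; apply: all_projective_semisimple allP; apply: tc_length.
Qed.
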